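(* Let $\mathcal{A}$ be a commutative C*-algebra, let $a_1, a_2 \in \mathcal{A}$, and let $P(z) = (z-a_1)(z-a_2)$ for $z \in \mathcal{A}$ (a polynomial of degree $n=2$ over $\mathcal{A}$). Let $z \in \mathcal{A}$ be such that $z$ is not a critical point of $P$. Then: (1) there exists a critical point $w \in \mathcal{A}$ of $P$ such that $$(P(z)-P(w))(P(z)-P(w))^* \leq (z-w)P'(z)P'(z)^*(z-w)^*$$ or $$(P(z)-P(w))(P(z)-P(w))^* \leq \left(\frac{n-1}{n}\right)^2 (z-w)P'(z)P'(z)^*(z-w)^* = \frac14 (z-w)P'(z)P'(z)^*(z-w)^*;$$ (2) there exists a critical point $w \in \mathcal{A}$ of $P$ such that $$\frac{(z-w)P'(z)P'(z)^*(z-w)^*}{n^2} = \frac{(z-w)P'(z)P'(z)^*(z-w)^*}{4} \leq (P(z)-P(w))(P(z)-P(w))^*.$$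
   Context: C*-algebras are complex and not assumed unital. For $P(z) = (z-a_1)(z-a_2)$ with $a_1,a_2 \in \mathcal{A}$, the derivative is defined by $P'(z) = (z-a_2) + (z-a_1)$ for all $z \in \mathcal{A}$ (the sum over $j$ of the product with the factor $z-a_j$ omitted). An element $w \in \mathcal{A}$ is a critical point of $P$ if $P'(w) = 0$; thus $z$ is not a critical point of $P$ if $P'(z) \neq 0$. The relation $\leq$ between self-adjoint elements is the usual order of a C*-algebra: $x \leq y$ if and only if $y - x$ is positive. *)

(* Defs.v *)
From HB Require Import structures.
From mathcomp Require Import all_boot all_order all_algebra.
From mathcomp Require Import all_classical all_reals all_analysis.
From mathcomp Require Import complex.

Set Implicit Arguments.
Unset Strict Implicit.
Unset Printing Implicit Defensive.

Import Order.TTheory GRing.Theory Num.Theory.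
Import numFieldNormedType.Exports.

Local Open Scope classical_set_scope.
Local Open Scope ring_scope.
Local Open Scope complex_scope.

(* Complex C*-algebras, not assumed unital: the underlying Banach space over
   R[i] is the library's, but its rings all have a unit, so the product is part
   of the mixin.  As for every normed module over R[i], the norm is R[i]-valued
   (with nonnegative real values). *)
HB.mixin Record CompleteNormedModule_isCStarAlgebra (R : realType) (A : Type)
    of CompleteNormedModule R[i] A := {
  cmul : A -> A -> A;
  cstar : A -> A;
  cmulA : associative cmul;
  cmulDl : left_distributive cmul +%R;
  cmulDr : right_distributive cmul +%R;
  cscaleAl : forall (k : R[i]) (x y : A), cmul (k *: x) y = k *: cmul x y;
  cscaleAr : forall (k : R[i]) (x y : A), cmul x (k *: y) = k *: cmul x y;
  cstarK : involutive cstar;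
  cstarD : {morph cstar : x y / x + y};
  cstarZ : forall (k : R[i]) (x : A), cstar (k *: x) = Num.conj k *: cstar x;
  cstarM : forall x y : A, cstar (cmul x y) = cmul (cstar y) (cstar x);
  cnormM : forall x y : A, `|cmul x y| <= `|x| * `|y|;
  cnorm_star_mul : forall x : A, `|cmul (cstar x) x| = `|x| ^+ 2
}.

#[short(type="cstarAlgType")]
HB.structure Definition CStarAlgebra (R : realType) :=
  { A of CompleteNormedModule_isCStarAlgebra R A & CompleteNormedModule R[i] A }.

Declare Scope cstar_scope.
Delimit Scope cstar_scope with cstar.
Notation "x ** y" := (cmul x y)
  (at level 40, left associativity) : cstar_scope.
Notation "x ^*" := (cstar x) : cstar_scope.
Local Open Scope cstar_scope.

Section Order.
Variables (R : realType) (A : cstarAlgType R).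
Implicit Types (x y : A) (u v : A * R[i]).

(* The product of the unitization A + C 1, where (x, k) stands for x + k 1. *)
Definition unitization_mul u v : A * R[i] :=
  (u.1 ** v.1 + u.2 *: v.1 + v.2 *: u.1, u.2 * v.2).

Definition unitization_one : A * R[i] := (0, 1).

(* The spectrum is taken in the unitization even if A has a unit, in which case
   it is the spectrum relative to A with 0 added; this does not affect
   positivity. *)
Definition spectrum x : set R[i] :=
  [set k | ~ exists u, unitization_mul (x, - k) u = unitization_one /\
                       unitization_mul u (x, - k) = unitization_one].

(* [0 <= k] in R[i] means that k is real and nonnegative. *)
Definition cstar_pos x : Prop :=
  x^* = x /\ spectrum x `<=` [set k | 0 <= k].

Definition cstar_le x y : Prop := cstar_pos (y - x).

End Order.

Section Quadratic.
Variables (R : realType) (A : cstarAlgType R).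

Definition quad (a1 a2 z : A) : A := (z - a1) ** (z - a2).

Definition quad_deriv (a1 a2 z : A) : A := (z - a2) + (z - a1).

Definition critical_point (a1 a2 w : A) : Prop := quad_deriv a1 a2 w = 0.

End Quadratic.

(* Main.v *)
(** The midpoint w of a1 and a2 is a critical point, P(z) - P(w) = (z - w)^2 and
    P'(z) = 2 (z - w).  Hence the inequality with factor 1/4 and the reverse
    inequality both hold at w, with equality. *)

Require Import Defs.
From mathcomp Require Import all_boot all_order all_algebra.
From mathcomp Require Import all_classical all_reals all_analysis.
From mathcomp Require Import complex.

Set Implicit Arguments.
Unset Strict Implicit.
Unset Printing Implicit Defensive.

Import Order.TTheory GRing.Theory Num.Theory.
Import numFieldNormedType.Exports.

Local Open Scope ring_scope.
Local Open Scope cstar_scope.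

Section CStarAlgebraTheory.
Variables (R : realType) (A : cstarAlgType R).
Implicit Types (x y : A) (k : R[i]%C).

Lemma cmul0l x : 0 ** x = 0 :> A.
Proof. by apply: (addrI (0 ** x)); rewrite -cmulDl !addr0. Qed.

Lemma cmulNr x y : x ** (- y) = - (x ** y) :> A.
Proof. by rewrite -scaleN1r cscaleAr scaleN1r. Qed.

Lemma cstar0 : (0 : A)^* = 0.
Proof. by apply: (addrI ((0 : A)^*)); rewrite -cstarD !addr0. Qed.

(** For [k != 0], the element [0 - k 1] of the unitization is a nonzero scalar, with inverse
    [- k^-1] times the unit. *)
Lemma spectrum0 k : spectrum (0 : A) k -> k = 0.
Proof.
move=> k_spec; apply/eqP/negPn/negP => k_neq0.
apply: k_spec; exists (0, - k^-1).
rewrite /unitization_mul /unitization_one /= cmul0l !scaler0 !addr0.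
by rewrite !mulrNN mulfV ?mulVf.
Qed.

Lemma cstar_pos0 : cstar_pos (0 : A).
Proof. by split=> [|k /spectrum0 -> /=]; [exact: cstar0 | exact: lexx]. Qed.

(** Reduces to the positivity of 0. The order enters the theorem only through this fact, since both
    bounds are attained. *)
Lemma cstar_le_refl x : cstar_le x x.
Proof. by rewrite /cstar_le subrr; exact: cstar_pos0. Qed.

End CStarAlgebraTheory.

Section MidpointCriticalPoint.
Variables (R : realType) (A : cstarAlgType R) (a1 a2 : A).

Definition midpoint : A := 2^-1 *: (a1 + a2).

Lemma quad_deriv_midpoint z : quad_deriv a1 a2 z = 2 *: (z - midpoint).
Proof.
rewrite scalerBr scalerA mulfV ?pnatr_eq0// scale1r scaler_nat mulr2n.
by rewrite /quad_deriv addrACA -opprD [a2 + a1]addrC.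
Qed.

Lemma critical_midpoint : critical_point a1 a2 midpoint.
Proof. by rewrite /critical_point quad_deriv_midpoint subrr scaler0. Qed.

(** With [d = z - w] and [e = w - a1], criticality of [w] gives [w - a2 = - e], so the difference is
    [(d + e) ** (d - e) + e ** e]. Commutativity cancels the cross terms. *)
Lemma quad_sub_midpoint (mulC : commutative (@cmul R A)) z :
  quad a1 a2 z - quad a1 a2 midpoint = (z - midpoint) ** (z - midpoint).
Proof.
set w := midpoint; set d := z - w; set e := w - a1.
have a2E : w - a2 = - e.
  apply/eqP; rewrite -addr_eq0; apply/eqP.
  by have := critical_midpoint; rewrite /critical_point /quad_deriv.
have zE a : z - a = d + (w - a) by rewrite /d addrA subrK.
(* Without their bodies, [d] and [e] are atoms that distributivity cannot expand further. *)
rewrite /quad !zE a2E -/e; clearbody d e.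
rewrite cmulDl !cmulDr !cmulNr (mulC d e).
by rewrite addrA subrK addrK.
Qed.

Lemma quad_sub_midpoint_sqr (mulC : commutative (@cmul R A)) z
    (D := quad a1 a2 z - quad a1 a2 midpoint) (P' := quad_deriv a1 a2 z) :
  D ** D^* =
    4^-1 *: ((z - midpoint) ** P' ** P'^* ** (z - midpoint)^*).
Proof.
rewrite /D /P' quad_sub_midpoint// quad_deriv_midpoint; set d := z - _.
(* [P'] and [P'^*] each contribute a factor 2, which conjugation fixes; their product cancels
   [4^-1]. Both sides are then [d ** d ** d^* ** d^*] up to association. *)
rewrite cstarZ conjC_nat cstarM !(cscaleAl, cscaleAr) !scalerA -!cmulA.
by rewrite -natrM mulVf ?pnatr_eq0// scale1r.
Qed.

End MidpointCriticalPoint.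

Theorem mainTheorem3 (R : realType) (A : cstarAlgType R)
    (mulC : commutative (@cmul R A)) (a1 a2 z : A)
    (P := quad a1 a2) (P' := quad_deriv a1 a2) (n := 2%N)
    (hz : ~ critical_point a1 a2 z) :
  (exists w : A, critical_point a1 a2 w /\
     (cstar_le ((P z - P w) ** (P z - P w)^*)
               ((z - w) ** P' z ** (P' z)^* ** (z - w)^*) \/
      cstar_le ((P z - P w) ** (P z - P w)^*)
               (((n%:R - 1) / n%:R) ^+ 2 *:
                  ((z - w) ** P' z ** (P' z)^* ** (z - w)^*)))) /\
  (exists w : A, critical_point a1 a2 w /\
     cstar_le ((n%:R ^+ 2)^-1 *: ((z - w) ** P' z ** (P' z)^* ** (z - w)^*))
              ((P z - P w) ** (P z - P w)^*)).
Proof.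
pose w := midpoint a1 a2.
have w_crit : critical_point a1 a2 w := critical_midpoint a1 a2.
(* At [n = 2] the constants [((n - 1) / n)^2] and [1 / n^2] coincide, so one identity serves both
   parts. *)
have quarterE : ((n%:R - 1) / n%:R) ^+ 2 = 4^-1 :> R[i]%C.
  by rewrite /n -(@natrB _ 2 1)// mul1r exprVn -natrX.
have sqrE : (n%:R ^+ 2)^-1 = 4^-1 :> R[i]%C by rewrite /n -natrX.
split; exists w; split=> //.
  right; rewrite quarterE /P (quad_sub_midpoint_sqr _ _ mulC).
  exact: cstar_le_refl.
rewrite sqrE /P (quad_sub_midpoint_sqr _ _ mulC).
exact: cstar_le_refl.
Qed.
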